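(* Let $H$ be a Hilbert space, let $C\subset H$ be nonempty, bounded, closed and convex, and let $F:C\times C\to C$ be a weakly nonexpansive and demicompact operator. Then the set of coupled fixed points of $F$ is nonempty and, for every $\lambda\in(0,1)$ and every $x_0\in C$, the double sequence $\{(x_n,x_n)\}_{n\ge 0}$ defined by $$x_{n+1}=\lambda x_n+(1-\lambda)F(x_n,x_n),\quad n\ge 0,$$ converges strongly (in norm) to a coupled fixed point of $F$.
   Context: A mapping $F:C\times C\to H$, with $C$ a subset of a normed linear space $H$, is called weakly nonexpansive if there are constants $a,b\ge 0$ with $a+b\le 1$ such that $\|F(x,y)-F(u,v)\|\le a\|x-u\|+b\|y-v\|$ for all $x,y,u,v\in C$. A pair $(x,y)\in C\times C$ is a coupled fixed point of $F$ if $F(x,y)=x$ and $F(y,x)=y$. For $C$ a subset of a Hilbert space $H$, a mapping $F:C\times C\to H$ is called demicompact if whenever $\{u_n\}$ and $\{v_n\}$ are bounded sequences in $C$ such that $\{F(u_n,v_n)-u_n\}$ and $\{F(v_n,u_n)-v_n\}$ converge strongly, there exists a subsequence $\{(u_{n_k},v_{n_k})\}$ of $\{(u_n,v_n)\}$ and points $u,v$ such that $u_{n_k}\to u$ and $v_{n_k}\to v$ strongly. *)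

(* Defs.v *)
From mathcomp Require Import all_boot all_order all_algebra.
From mathcomp Require Import complex.
From mathcomp Require Import all_classical all_reals all_analysis.

Set Implicit Arguments.
Unset Strict Implicit.
Unset Printing Implicit Defensive.

Import Order.TTheory GRing.Theory Num.Theory.
Import numFieldNormedType.Exports.

Local Open Scope classical_set_scope.
Local Open Scope ring_scope.

(* The scalar field of a Hilbert space is R or R[i], where R is a model of the
   real numbers; the second index is the conjugation with respect to which the
   inner product is sesquilinear.  In the order of a numFieldType,
   0 <= a entails that a is real, so inequalities between scalars of R[i] are
   inequalities between real numbers; in particular norms over R[i] are
   nonnegative reals. *)
Variant real_or_complex (R : realType) :
    forall K : numFieldType, (K -> K) -> Prop :=
| RealScalars : @real_or_complex R R idfun
| ComplexScalars : @real_or_complex R R[i] (@Num.conj R[i]).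

Section CoupledFixedPoints.
Context {K : numFieldType} {H : normedModType K}.

(* A mapping C * C -> H is given by a function on H * H of which only the
   values on C * C are ever used. *)
Implicit Types (C : set H) (F : H -> H -> H).

Definition weakly_nonexpansive C F :=
  exists a b : K, [/\ 0 <= a, 0 <= b, a + b <= 1 &
    forall x y u v, C x -> C y -> C u -> C v ->
      `|F x y - F u v| <= a * `|x - u| + b * `|y - v|].

Definition coupled_fixed_points C F : set (H * H) :=
  [set p | [/\ C p.1, C p.2, F p.1 p.2 = p.1 & F p.2 p.1 = p.2]].

Definition demicompact C F :=
  forall u v : nat -> H,
    (forall n, C (u n)) -> (forall n, C (v n)) ->
    bounded_fun u -> bounded_fun v ->
    cvg ((F (u n) (v n) - u n) @[n --> \oo]) ->
    cvg ((F (v n) (u n) - v n) @[n --> \oo]) ->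
  exists k : nat -> nat, {homo k : m n / (m < n)%N} /\
    exists p q : H, u (k n) @[n --> \oo] --> p /\ v (k n) @[n --> \oo] --> q.

End CoupledFixedPoints.

(* Main.v *)
Require Import Defs.
From mathcomp Require Import all_boot all_order all_algebra.
From mathcomp Require Import complex ring.
From mathcomp Require Import all_classical all_reals all_analysis.

(** The diagonal map [T z = F z z] is nonexpansive. Iterating the contractions
    [z |-> t x0 + (1 - t) T z] long enough, with [t] tending to 0, gives points
    [z_n] with [T z_n - z_n --> 0]; demicompactness extracts a limit point, which
    is a fixed point of [T]. For a fixed point [p], the Hilbert space identity for
    [|l u + (1 - l) v|^2] yields
    [|x_(n+1) - p|^2 <= |x_n - p|^2 - l (1 - l) |T x_n - x_n|^2], so that
    [T x_n - x_n --> 0]. Demicompactness now gives a subsequence of [x_n]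
    converging to a fixed point, and the distance of [x_n] to this point is
    nonincreasing. *)

Set Implicit Arguments.
Unset Strict Implicit.
Unset Printing Implicit Defensive.

Import Order.TTheory GRing.Theory Num.Theory.
Import numFieldNormedType.Exports.

Local Open Scope classical_set_scope.
Local Open Scope ring_scope.

(** * Order and conjugation on real or complex scalars *)

Section Scalars.
Variables (R : realType) (K : numFieldType) (conj : K -> K).
Hypothesis scalars : real_or_complex R conj.

(** In [R[i]], [0 <= z] forces a zero imaginary part, so the Archimedean property of [R] applies to
    the real part. *)
Lemma real_or_complex_archi (z : K) : 0 <= z -> exists n, z < n%:R.
Proof.
case: scalars z => z z0; first by exists (Num.bound z); exact: archi_boundP.
have [imz rez] : complex.Im z = 0 /\ 0 <= complex.Re z.
  by move: z0; rewrite lecE => /andP[/eqP -> ->].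
exists (Num.bound (complex.Re z)).
rewrite -(rmorph_nat (@real_complex R)) ltcE /= imz eqxx /=.
exact: archi_boundP.
Qed.

(** Lets convex weights, being nonnegative, come out of [dot] unconjugated. *)
Lemma real_or_complex_conj (z : K) : 0 <= z -> conj z = z.
Proof. by case: scalars z => // z /geC0_conj. Qed.

End Scalars.

(** * The Hilbert space identity *)

Section SquareNorm.
Context {K : numFieldType} {conj : K -> K} {H : normedModType K}.
Variable dot : {dot H for conj}.
Hypothesis dot_norm : forall x : H, `|x| ^+ 2 = dot x x.

(** After expansion by sesquilinearity, the cross terms [dot x y] and [dot y x] have coefficient
    [l * (1 - l)] on both sides. *)
Lemma sqr_norm_convex (l : K) (x y : H) :
  conj l = l -> conj (1 - l) = 1 - l ->
  `|l *: x + (1 - l) *: y| ^+ 2 =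
  l * `|x| ^+ 2 + (1 - l) * `|y| ^+ 2 - l * (1 - l) * `|x - y| ^+ 2.
Proof.
move=> cl c1l; rewrite !dot_norm !linearDl !linearDr /=.
rewrite !linearZl_LR !linearZr_LR /= !linearNr !linearNl /= cl c1l.
(* Linearity of [dot] leaves scalings in [K^o], which [ring] must see as products. *)
have scaleE (a b : K) : a *: (b : K^o) = a * b by [].
rewrite !scaleE; ring.
Qed.

End SquareNorm.

(** * Scalar estimates *)

Section Archimedean.
Variable K : numFieldType.
Hypothesis archi : forall z : K, 0 <= z -> exists n, z < n%:R.

Lemma archi_divn_lt (D e : K) : 0 <= D -> 0 < e ->
  exists N, forall n, (N <= n)%N -> D / n.+1%:R < e.
Proof.
move=> D0 e0; have [N De] := archi (divr_ge0 D0 (ltW e0)).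
exists N => n Nn; rewrite ltr_pdivrMr ?ltr0n// mulrC -ltr_pdivrMr//.
by rewrite (lt_le_trans De)// ler_nat (leq_trans Nn).
Qed.

(** The induction rests on [(1 - t) * (1 + (n+1) t) = 1 + n t - (n+1) t^2]. *)
Lemma bernoulli_expr1B (t : K) n :
  0 <= t <= 1 -> (1 - t) ^+ n * (1 + n%:R * t) <= 1.
Proof.
case/andP=> t0 t1; have t1' : 0 <= 1 - t by rewrite subr_ge0.
elim: n => [|n IH]; first by rewrite mul0r addr0 mulr1.
apply: le_trans IH; rewrite exprSr -mulrA ler_wpM2l ?exprn_ge0//.
rewrite -subr_ge0 (_ : _ - _ = n.+1%:R * t ^+ 2) ?mulr_ge0 ?exprn_ge0//.
by rewrite -natr1; ring.
Qed.

(** As soon as [n > M / e^2], having [e <= d n] would give [n * d n ^+ 2 > M]. It is meant for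
    residuals whose squares have bounded partial sums. *)
Lemma nonincreasing_small (d : nat -> K) (M : K) :
  (forall n, 0 <= d n) -> (forall n, d n.+1 <= d n) ->
  (forall n, n%:R * d n ^+ 2 <= M) ->
  forall e, 0 < e -> exists N, forall n, (N <= n)%N -> d n < e.
Proof.
move=> d0 dS dM e e0; have M0 : 0 <= M by rewrite (le_trans _ (dM 0%N))// mul0r.
have [N MN] := archi (divr_ge0 M0 (exprn_ge0 2 (ltW e0))).
exists N => n Nn.
(* The order of [K] may be partial; negating [<] is legitimate since both sides are nonnegative,
   hence real. *)
rewrite real_ltNge ?ger0_real ?(ltW e0)//; apply/negP => edn.
suff : M < M by rewrite ltxx.
rewrite (ltr_pdivrMr _ _ (exprn_gt0 2 e0)) in MN.
apply: lt_le_trans (dM n); rewrite (lt_le_trans MN)//.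
by apply: ler_pM; rewrite ?exprn_ge0 ?ler_nat ?lerXn2r ?nnegrE ?(ltW e0).
Qed.

End Archimedean.

(** * Fixed points of a nonexpansive demicompact map *)

Section Nonexpansive.
Context {K : numFieldType} {H : normedModType K}.
Hypothesis archi : forall z : K, 0 <= z -> exists n, z < n%:R.

Lemma seq_norm_lt_cvg (u : nat -> H) (l : H) :
  (forall e, 0 < e -> exists N, forall n, (N <= n)%N -> `|u n - l| < e) ->
  u n @[n --> \oo] --> l.
Proof.
move=> ul; apply/cvgrPdist_lt => e /ul[N uN].
by exists N => // n /= Nn; rewrite distrC uN.
Qed.

Lemma cvg_seq_norm_lt (u : nat -> H) (l : H) (e : K) :
  u n @[n --> \oo] --> l -> 0 < e ->
  exists N, forall n, (N <= n)%N -> `|u n - l| < e.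
Proof.
move=> /cvgrPdist_lt /[apply] -[N _ uN].
by exists N => n Nn; rewrite distrC; exact: uN.
Qed.

Variables (C : set H) (T : H -> H).
Hypotheses (C_bounded : bounded_set C) (C_closed : closed C).
Hypothesis C_convex : forall (t : K) x y, 0 <= t <= 1 -> C x -> C y ->
  C (t *: x + (1 - t) *: y).
Hypothesis T_maps : forall x, C x -> C (T x).
Hypothesis T_nonexpansive : forall x y, C x -> C y -> `|T x - T y| <= `|x - y|.
Hypothesis T_demicompact : forall u : nat -> H, (forall n, C (u n)) ->
  T (u n) - u n @[n --> \oo] --> 0 ->
  exists k : nat -> nat, {homo k : m n / (m < n)%N} /\
    exists p : H, u (k n) @[n --> \oo] --> p.

Lemma bounded_diameter : exists2 D : K, 0 <= D &
  forall x y, C x -> C y -> `|x - y| <= D.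
Proof.
have [M M0 CM] := ex_strict_bound_gt0 C_bounded.
exists (M + M) => [|x y Cx Cy]; first by rewrite addr_ge0 ?ltW.
by rewrite (le_trans (ler_normB _ _))// lerD// ltW// CM.
Qed.

Lemma approximate_fixed_points x0 : C x0 -> exists z : nat -> H,
  (forall n, C (z n)) /\ T (z n) - z n @[n --> \oo] --> 0.
Proof.
move=> Cx0; have [D D0 CD] := bounded_diameter.
pose S t x : H := t *: x0 + (1 - t) *: T x.
have SC t n : 0 <= t <= 1 -> C (iter n (S t) x0).
  by move=> t01; elim: n => //= n IH; apply: C_convex => //; exact: T_maps.
have S_step t n : 0 <= t <= 1 ->
    `|iter n.+1 (S t) x0 - iter n (S t) x0| <= (1 - t) ^+ n * D.
  move=> t01; elim: n => [|n IH].
    by rewrite mul1r CD//; exact: (SC t 1%N).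
  rewrite !iterS /S -/(S t) opprD addrACA subrr add0r -scalerBr normrZ.
  have t1 : 0 <= 1 - t by case/andP: t01; rewrite subr_ge0.
  rewrite ger0_norm// exprS -mulrA ler_wpM2l//.
  by apply: le_trans IH; apply: T_nonexpansive; [exact: (SC t n.+1)|exact: SC].
have t01 n : 0 <= (n.+1%:R^-1 : K) <= 1.
  by rewrite invr_ge0 ler0n invf_le1 ?ltr0n ?ler1n.
(* By Bernoulli, [(n+1)^2] steps bring the factor [(1 - t) ^+ n] of [S_step]
   below [t = 1 / (n+1)]. *)
pose z n := iter (n.+1 ^ 2)%N (S n.+1%:R^-1) x0.
have zC n : C (z n) by exact: SC.
exists z; split=> //; apply: seq_norm_lt_cvg => e e0.
have [N DN] := archi_divn_lt archi (addr_ge0 D0 D0) e0.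
exists N => n Nn; rewrite subr0; apply: le_lt_trans (DN n Nn).
set t : K := n.+1%:R^-1.
(* Each of the two summands has norm at most [D / n.+1]. *)
rewrite (_ : _ - _ = (S t (z n) - z n) + t *: (T (z n) - x0)); last first.
  rewrite /S scalerBl scale1r scalerBr [t *: x0 + _]addrC -!addrA.
  by congr (_ + _); rewrite [- z n + _]addrC [t *: x0 + _]addrA subrKC addKr.
rewrite mulrDl (le_trans (ler_normD _ _))// lerD//.
  apply: le_trans (S_step t (n.+1 ^ 2)%N (t01 n)) _; rewrite mulrC ler_wpM2l//.
  rewrite -[leRHS]mulr1 ler_pdivlMl ?ltr0n// mulrC.
  (* With [(n+1)^2] steps, the Bernoulli factor is [1 + (n+1)], which dominates the [n+1]
     required. *)
  apply: le_trans (bernoulli_expr1B (n.+1 ^ 2)%N (t01 n)).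
  case/andP: (t01 n) => t0 t1.
  rewrite ler_wpM2l ?exprn_ge0 ?subr_ge0// natrX expr2 mulfK ?pnatr_eq0//.
  by rewrite lerDr ler01.
case/andP: (t01 n) => t0 t1.
by rewrite normrZ ger0_norm// mulrC ler_wpM2r// CD//; exact: T_maps.
Qed.

(** Serves both existence and convergence. Closedness keeps the limit [p] in [C], and passing from
    [T p] to [p] through [T (z (k n))] and [z (k n)] costs three terms below [e / 3]. *)
Lemma cvg_subseq_fixed_point (z : nat -> H) : (forall n, C (z n)) ->
  T (z n) - z n @[n --> \oo] --> 0 ->
  exists k : nat -> nat, exists p : H, [/\ C p, T p = p &
    z (k n) @[n --> \oo] --> p].
Proof.
move=> zC Tz0; have [k [kS [p zkp]]] := T_demicompact zC Tz0.
exists k, p.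
have Cp : C p by apply: (closed_cvg C C_closed _ _ zkp); exact: nearW.
split=> //; apply/eqP; rewrite -subr_eq0 -normr_le0.
apply/ler_addgt0Pr => e e0; rewrite add0r.
have e3 : 0 < e / 3%:R by rewrite divr_gt0 ?ltr0n.
have [N1 zN] := cvg_seq_norm_lt zkp e3.
have [N2 TN] := cvg_seq_norm_lt Tz0 e3.
(* Transfers the bound on the residuals to the subsequence. *)
have kn n : (n <= k n)%N by elim: n => // n IH; exact: leq_ltn_trans IH (kS _ _ _).
pose n := maxn N1 N2.
have /ltW zn : `|z (k n) - p| < e / 3%:R by apply: zN; rewrite leq_maxl.
have /ltW Tn : `|T (z (k n)) - z (k n)| < e / 3%:R.
  by rewrite -[X in `|X|]subr0; apply: TN; rewrite (leq_trans _ (kn n))// leq_maxr.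
have -> : T p - p = (T p - T (z (k n))) + (T (z (k n)) - z (k n)) + (z (k n) - p).
  by rewrite !addrA !subrK.
rewrite (le_trans (ler_normD _ _))//.
rewrite (_ : e = e / 3%:R + e / 3%:R + e / 3%:R); last by field.
rewrite lerD// (le_trans (ler_normD _ _))// lerD//.
by rewrite (le_trans (T_nonexpansive Cp (zC _)))// distrC.
Qed.

Lemma nonexpansive_fixed_point : C !=set0 -> exists2 p, C p & T p = p.
Proof.
case=> x0 /approximate_fixed_points[z [zC /(cvg_subseq_fixed_point zC)]].
by case=> k [p [Cp Tp _]]; exists p.
Qed.

(** * The Krasnoselskii iteration *)

Hypothesis sqr_norm_convex : forall (l : K) (x y : H), 0 <= l <= 1 ->
  `|l *: x + (1 - l) *: y| ^+ 2 =
  l * `|x| ^+ 2 + (1 - l) * `|y| ^+ 2 - l * (1 - l) * `|x - y| ^+ 2.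

Variables (l : K) (x : nat -> H).
Hypotheses (l01 : 0 < l < 1) (x0C : C (x 0%N)).
Hypothesis xS : forall n, x n.+1 = l *: x n + (1 - l) *: T (x n).

Let l0 : 0 <= l. Proof. by case/andP: l01 => /ltW. Qed.
Let l1 : 0 <= 1 - l. Proof. by case/andP: l01 => _ /ltW; rewrite subr_ge0. Qed.
Let l01W : 0 <= l <= 1. Proof. by rewrite l0 -subr_ge0. Qed.

Lemma krasnoselskii_in_set n : C (x n).
Proof.
by elim: n => // n IH; rewrite xS; apply: C_convex => //; exact: T_maps.
Qed.

(** In the identity for [l *: (x n - p) + (1 - l) *: (T (x n) - p)], the point [p] cancels from the
    last term, and [p = T p] gives [|T (x n) - p| <= |x n - p|]. *)
Lemma krasnoselskii_dist_fixed p n : C p -> T p = p ->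
  `|x n.+1 - p| ^+ 2 <=
  `|x n - p| ^+ 2 - l * (1 - l) * `|T (x n) - x n| ^+ 2.
Proof.
move=> Cp Tp.
have -> : x n.+1 - p = l *: (x n - p) + (1 - l) *: (T (x n) - p).
  by rewrite xS !scalerBr addrACA -opprD -scalerDl subrKC scale1r.
rewrite sqr_norm_convex// opprB addrA subrK [`|x n - T _|]distrC lerB//.
rewrite [leRHS](_ : _ = l * `|x n - p| ^+ 2 + (1 - l) * `|x n - p| ^+ 2); last ring.
rewrite lerD2l ler_wpM2l//.
rewrite lerXn2r ?nnegrE ?normr_ge0// -{1}Tp T_nonexpansive//.
exact: krasnoselskii_in_set.
Qed.

Lemma krasnoselskii_dist_le p n : C p -> T p = p -> `|x n.+1 - p| <= `|x n - p|.
Proof.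
move=> Cp Tp; rewrite -(@ler_pXn2r _ 2) ?nnegrE//.
rewrite (le_trans (krasnoselskii_dist_fixed n Cp Tp))// gerBl.
by rewrite !mulr_ge0// exprn_ge0.
Qed.

(** Going through [T (x n)] splits the new residual into parts of norm at most [1 - l] and [l] times
    the old one. *)
Lemma krasnoselskii_residual_le n :
  `|T (x n.+1) - x n.+1| <= `|T (x n) - x n|.
Proof.
have Cx := krasnoselskii_in_set.
have xB : x n.+1 - x n = (1 - l) *: (T (x n) - x n).
  by rewrite xS scalerBr addrAC -opprB addrC; congr (_ - _);
    rewrite scalerBl scale1r.
have TB : T (x n) - x n.+1 = l *: (T (x n) - x n).
  rewrite -[T _ - x n.+1](subrKA (x n)) -[x n - _]opprB xB.
  by rewrite -{1}[T _ - _]scale1r -scalerBl subKr.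
rewrite -(subrKA (T (x n))) (le_trans (ler_normD _ _))// TB.
rewrite (le_trans (lerD (T_nonexpansive (Cx _) (Cx _)) (lexx _)))//.
by rewrite xB !normrZ !ger0_norm// -mulrDl subrK mul1r.
Qed.

Lemma krasnoselskii_asymptotic_regularity : T (x n) - x n @[n --> \oo] --> 0.
Proof.
have [|p Cp Tp] := nonexpansive_fixed_point; first by exists (x 0%N).
have c0 : 0 < l * (1 - l) by case/andP: l01 => ? ?; rewrite mulr_gt0 ?subr_gt0.
apply: seq_norm_lt_cvg => e e0.
have [||n|N xN] := @nonincreasing_small K archi
  (fun n => `|T (x n) - x n|) (`|x 0%N - p| ^+ 2 / (l * (1 - l))) _ _ _ e e0.
- by [].
- exact: krasnoselskii_residual_le.
- rewrite ler_pdivlMr// mulrAC -mulrA.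
  (* Telescoping: each step lowers the squared distance to [p] by at least [l * (1 - l)] times the
     squared residual, and the last of these residuals is the smallest. Keeping [|x n - p|^2] makes
     the induction go through. *)
  apply: (@le_trans _ _ (`|x 0%N - p| ^+ 2 - `|x n - p| ^+ 2)); last first.
    by rewrite gerBl exprn_ge0.
  elim: n => [|n IH]; first by rewrite mul0r subrr.
  have le_d : l * (1 - l) * `|T (x n.+1) - x n.+1| ^+ 2 <=
      l * (1 - l) * `|T (x n) - x n| ^+ 2.
    by rewrite ler_wpM2l ?(ltW c0)// lerXn2r ?nnegrE// krasnoselskii_residual_le.
  rewrite -natr1 mulrDl mul1r -[leRHS](subrKA (`|x n - p| ^+ 2)) lerD//.
    by apply: le_trans IH; rewrite ler_wpM2l.
  by rewrite (le_trans le_d)// lerBrDr addrC -lerBrDr krasnoselskii_dist_fixed.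
- by exists N => n Nn; rewrite subr0 xN.
Qed.

Lemma krasnoselskii_cvg : exists p : H, [/\ C p, T p = p & x n @[n --> \oo] --> p].
Proof.
have [k [p [Cp Tp xkp]]] :=
  cvg_subseq_fixed_point krasnoselskii_in_set krasnoselskii_asymptotic_regularity.
exists p; split=> //; apply: seq_norm_lt_cvg => e /(cvg_seq_norm_lt xkp)[N xN].
(* A single subsequence term within [e] of [p] traps all later iterates. *)
exists (k N) => n; elim: n => [|n IH].
  by rewrite leqn0 => /eqP kN; have := xN N (leqnn N); rewrite kN.
rewrite leq_eqVlt => /orP[/eqP<-|]; first exact: xN.
by rewrite ltnS => /IH; apply: le_lt_trans; exact: krasnoselskii_dist_le.
Qed.

End Nonexpansive.

(** Replaces the interval-typed weights of [convex_set] by scalars with an inequality. *)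
Lemma convex_set_comb (K : numFieldType) (H : normedModType K) (C : set H) :
  convex_set (C : set (convex_lmodType H)) ->
  forall (t : K) x y, 0 <= t <= 1 -> C x -> C y -> C (t *: x + (1 - t) *: y).
Proof.
move=> C_convex t x y t01 Cx Cy.
have := C_convex x y (Itv01 (proj1 (andP t01)) (proj2 (andP t01))).
by rewrite !inE; apply.
Qed.

Theorem theorem3 (R : realType) (K : numFieldType) (conj : K -> K)
    (scalars : real_or_complex R conj)
    (H : completeNormedModType K) (dot : {dot H for conj})
    (dot_norm : forall x : H, `|x| ^+ 2 = dot x x)
    (C : set H)
    (C_nonempty : C !=set0) (C_bounded : bounded_set C)
    (C_closed : closed C) (C_convex : convex_set (C : set (convex_lmodType H)))
    (F : H -> H -> H)
    (F_maps : forall x y : H, C x -> C y -> C (F x y))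
    (F_weakly_nonexpansive : weakly_nonexpansive C F)
    (F_demicompact : demicompact C F) :
  coupled_fixed_points C F !=set0 /\
  (forall (lambda : K) (x0 : H), 0 < lambda < 1 -> C x0 ->
   forall x : nat -> H,
     x 0%N = x0 ->
     (forall n : nat,
        x n.+1 = lambda *: x n + (1 - lambda) *: F (x n) (x n)) ->
   exists p : H * H,
     coupled_fixed_points C F p /\ (x n, x n) @[n --> \oo] --> p).
Proof.
have archi := real_or_complex_archi scalars.
have convC := convex_set_comb C_convex.
pose T z := F z z.
have T_maps z : C z -> C (T z) by move=> Cz; exact: F_maps.
have T_ne z w : C z -> C w -> `|T z - T w| <= `|z - w|.
  case: F_weakly_nonexpansive => a [b [a0 b0 ab Fab]] Cz Cw.
  apply: (le_trans (Fab _ _ _ _ Cz Cz Cw Cw)).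
  by rewrite -mulrDl ler_piMl.
(* On the diagonal pair [u, u] both residuals in [demicompact] are [T (u n) - u n]. *)
have T_dc (u : nat -> H) : (forall n, C (u n)) ->
    T (u n) - u n @[n --> \oo] --> 0 ->
    exists k : nat -> nat, {homo k : m n / (m < n)%N} /\
      exists p : H, u (k n) @[n --> \oo] --> p.
  move=> Cu Tu0.
  have bu : bounded_fun u.
    have [M M0 CM] := ex_strict_bound_gt0 C_bounded.
    exists M; split; first exact: gtr0_real.
    by move=> N MN n _; rewrite /= (le_trans (ltW (CM _ (Cu n)))) ?ltW.
  have cu : cvg (F (u n) (u n) - u n @[n --> \oo]) by exact: cvgP Tu0.
  have [k [kS [p [q [up _]]]]] := F_demicompact u u Cu Cu bu bu cu cu.
  by exists k; split=> //; exists p.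
(* At [(p, p)] both coupled equations reduce to [T p = p]. *)
have T_coupled p : C p -> T p = p -> coupled_fixed_points C F (p, p) by [].
split.
  have [p Cp Tp] := nonexpansive_fixed_point archi C_bounded C_closed convC
    T_maps T_ne T_dc C_nonempty.
  by exists (p, p); exact: T_coupled.
move=> l x0 l01 Cx0 x x0E xS.
have sqr (m : K) (y z : H) : 0 <= m <= 1 -> `|m *: y + (1 - m) *: z| ^+ 2 =
    m * `|y| ^+ 2 + (1 - m) * `|z| ^+ 2 - m * (1 - m) * `|y - z| ^+ 2.
  case/andP=> m0 m1; apply: (sqr_norm_convex dot_norm);
    by apply: (real_or_complex_conj scalars); rewrite ?subr_ge0.
have Cx : C (x 0%N) by rewrite x0E.
have [p [Cp Tp xp]] := krasnoselskii_cvg archi C_bounded C_closed convC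
  T_maps T_ne T_dc sqr l01 Cx xS.
by exists (p, p); split; [exact: T_coupled|exact: cvg_pair].
Qed.
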